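(* Let $E \subseteq \mathbb{R}^2$ and let $D \subseteq \mathbb{P}^1$ be the set of directions of lines $\ell \subset \mathbb{R}^2$ such that $\dim_{\mathrm H}(E \cap \ell) = 1$. If $D \neq \varnothing$, then $$\dim_{\mathrm P} D + 1 \leq \dim_{\mathrm P} E.$$
   Context: $\dim_{\mathrm H}$ and $\dim_{\mathrm P}$ denote Hausdorff and packing dimension, respectively. $E$ is arbitrary (no measurability is assumed). $\mathbb{P}^{n-1} := \mathbb{S}^{n-1}/\{\pm 1\}$ is the set of directions of lines in $\mathbb{R}^n$ (with its usual metric inherited from the unit sphere); the direction of a line is the class $\{\pm v\}$ of unit vectors $v$ parallel to it. *)

(* Defs.v *)
From HB Require Import structures.
From mathcomp Require Import all_boot all_order all_algebra.
From mathcomp Require Import generic_quotient.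
From mathcomp Require Import all_classical all_reals all_analysis.

Set Implicit Arguments.
Unset Strict Implicit.
Unset Printing Implicit Defensive.

Import Order.TTheory GRing.Theory Num.Theory.
Import numFieldTopology.Exports.

Local Open Scope classical_set_scope.
Local Open Scope ring_scope.

Section dimensions.
Context {R : realType} {T : metricType R}.
Implicit Types (A : set T) (s d : R).

(* The diameter of the empty set is -oo here; [diam_pow] gives it weight 0. *)
Definition diam A : \bar R :=
  ereal_sup [set (mdist x y)%:E | x in A & y in A].

(* |A|^s with the convention 0^0 = 1 for nonempty A. *)
Definition diam_pow s A : \bar R :=
  if A == set0 then 0%E else poweR (diam A) s.

Definition hausdorff_premeasure s d A : \bar R :=
  ereal_inf [set (\sum_(i <oo) diam_pow s (U i))%E | U in
    [set U : nat -> set T | A `<=` \bigcup_i U i /\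
       forall i, (diam (U i) <= d%:E)%E]].

Definition hausdorff_measure s A : \bar R :=
  ereal_sup [set hausdorff_premeasure s d A | d in [set d : R | 0 < d]].

Definition hausdorff_dim A : \bar R :=
  ereal_inf [set s%:E | s in [set s : R | 0 <= s /\ hausdorff_measure s A = 0%E]].

Definition cball (x : T) (r : R) : set T := [set y | mdist x y <= r].

(* A d-packing of A: at most countably many pairwise disjoint closed balls
   centred in A, of radii at most d. *)
Definition is_packing d A (I : set nat) (c : nat -> T) (r : nat -> R) : Prop :=
  (forall i, I i -> A (c i) /\ 0 < r i <= d) /\
  trivIset I (fun i => cball (c i) (r i)).

(* Balls are weighted by (2 r)^s, the radius-based form of the packing measure
   used in metric spaces; in R^n, 2 r is the diameter of the ball. *)
Definition packing_premeasure s d A : \bar R :=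
  ereal_sup [set w | exists I c r, is_packing d A I c r /\
    w = \esum_(i in I) ((2 * r i) `^ s)%:E].

Definition packing_premeasure0 s A : \bar R :=
  ereal_inf [set packing_premeasure s d A | d in [set d : R | 0 < d]].

Definition packing_measure s A : \bar R :=
  ereal_inf [set (\sum_(i <oo) packing_premeasure0 s (U i))%E | U in
    [set U : nat -> set T | A `<=` \bigcup_i U i]].

Definition packing_dim A : \bar R :=
  ereal_inf [set s%:E | s in [set s : R | 0 <= s /\ packing_measure s A = 0%E]].

End dimensions.

(* An alias of 'rV[R]_n, whose library metric is the sup metric. *)
Definition euclidean (R : realType) (n : nat) : Type := 'rV[R]_n.

HB.instance Definition _ (R : realType) (n : nat) :=
  GRing.Lmodule.copy (euclidean R n) 'rV[R]_n.

Definition enorm (R : realType) (n : nat) (x : euclidean R n) : R :=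
  Num.sqrt (\sum_(i < n) (x : 'rV[R]_n) 0 i ^+ 2).

Section enorm_theory.
Context {R : realType} {n : nat}.
Implicit Types x y z : euclidean R n.

Let sqs x : R := \sum_(i < n) (x : 'rV[R]_n) 0 i ^+ 2.

Let sqs_ge0 x : 0 <= sqs x.
Proof. by apply: sumr_ge0 => i _; exact: sqr_ge0. Qed.

Lemma enorm_ge0 x : 0 <= enorm x. Proof. exact: sqrtr_ge0. Qed.

Lemma enorm_eq0 x : enorm x = 0 -> x = 0.
Proof.
move=> /eqP; rewrite sqrtr_eq0 => x0.
have /eqP : sqs x = 0 by apply/eqP; rewrite eq_le x0 sqs_ge0.
rewrite psumr_eq0; last by move=> i _; exact: sqr_ge0.
move=> /allP xi0; apply/matrixP => i j; rewrite (ord1 i) [RHS]mxE.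
by have := xi0 j (mem_index_enum j); rewrite /= sqrf_eq0 => /eqP.
Qed.

Lemma enorm0 : enorm (0 : euclidean R n) = 0.
Proof. by rewrite /enorm big1 ?sqrtr0// => i _; rewrite mxE expr0n. Qed.

Lemma enormN x : enorm (- x) = enorm x.
Proof. by congr Num.sqrt; apply: eq_bigr => i _; rewrite mxE sqrrN. Qed.

Lemma enormB x y : enorm (x - y) = enorm (y - x).
Proof. by rewrite -enormN opprB. Qed.

Lemma cauchy_schwarz x y :
  \sum_(i < n) (x : 'rV[R]_n) 0 i * (y : 'rV[R]_n) 0 i <= enorm x * enorm y.
Proof.
set a := fun i => (x : 'rV[R]_n) 0 i; set b := fun i => (y : 'rV[R]_n) 0 i.
set S := \sum_(i < n) _.
have SE : S = \sum_(i < n) a i * b i by [].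
have : 0 <= \sum_(i < n) \sum_(j < n) (a i * b j - a j * b i) ^+ 2.
  by apply: sumr_ge0 => i _; apply: sumr_ge0 => j _; exact: sqr_ge0.
have -> : \sum_(i < n) \sum_(j < n) (a i * b j - a j * b i) ^+ 2 =
    (sqs x * sqs y - S ^+ 2) *+ 2.
  transitivity (\sum_(i < n) \sum_(j < n) (a i ^+ 2 * b j ^+ 2
      + b i ^+ 2 * a j ^+ 2 - (a i * b i) * (a j * b j) *+ 2)).
    apply: eq_bigr => i _; apply: eq_bigr => j _.
    rewrite sqrrB !exprMn addrAC; congr (_ + _ - _ *+ 2).
      by rewrite [a j ^+ 2 * _]mulrC.
    by rewrite -!mulrA; congr (_ * _); rewrite mulrC [RHS]mulrC -!mulrA;
       congr (_ * _); rewrite mulrC.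
  under eq_bigr do rewrite sumrB big_split/= -!mulr_sumr sumrMnl -mulr_sumr.
  rewrite sumrB big_split/= -!mulr_suml sumrMnl -mulr_suml -SE.
  rewrite -/(sqs x) -/(sqs y) [sqs y * _]mulrC.
  by rewrite -mulr2n -expr2 mulrnBl.
rewrite pmulrn_lge0// subr_ge0 => S2.
rewrite -sqrtrM ?sqs_ge0//.
by rewrite (le_trans (ler_norm S))// -sqrtr_sqr ler_wsqrtr.
Qed.

Lemma enormD x y : enorm (x + y) <= enorm x + enorm y.
Proof.
rewrite -(@ler_pXn2r _ 2)// ?nnegrE ?addr_ge0 ?enorm_ge0//.
rewrite sqrrD !sqr_sqrtr ?sqs_ge0//.
have -> : \sum_(i < n) (x + y : 'rV[R]_n) 0 i ^+ 2 = sqs x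
    + (\sum_(i < n) (x : 'rV[R]_n) 0 i * (y : 'rV[R]_n) 0 i) *+ 2 + sqs y.
  rewrite /sqs -sumrMnl -!big_split/=; apply: eq_bigr => i _.
  by rewrite mxE sqrrD.
by rewrite lerD2r lerD2l lerMn2r/= cauchy_schwarz.
Qed.

Definition edist x y : R := enorm (x - y).

Lemma edistxx x : edist x x = 0.
Proof. by rewrite /edist subrr enorm0. Qed.

Lemma edist_positivity x y : edist x y = 0 -> x = y.
Proof. by move=> /enorm_eq0/eqP; rewrite subr_eq0 => /eqP. Qed.

Lemma edist_sym x y : edist x y = edist y x.
Proof. exact: enormB. Qed.

Lemma edist_triangle y x z : edist x z <= edist x y + edist y z.
Proof. by rewrite /edist -(subrKA y x) enormD. Qed.

HB.instance Definition _ := isMetric.Build R (euclidean R n)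
  edistxx edist_positivity edist_sym edist_triangle.

End enorm_theory.

Definition sphere (R : realType) (n : nat) : Type :=
  {x : euclidean R n | enorm x == 1}.
HB.instance Definition _ (R : realType) (n : nat) := Choice.on (sphere R n).

Section directions.
Context {R : realType} {n : nat}.
Implicit Types u v w : sphere R n.

Definition antipodal u v : bool := (val u == val v) || (val u == - val v).

Lemma antipodal_equiv : equiv_class_of antipodal.
Proof.
split=> [u|u v|v u w]; rewrite /antipodal ?eqxx//.
  by rewrite (eq_sym (val u)) -eqr_oppLR (eq_sym (- val u)).
by move=> /orP[]/eqP-> /orP[]/eqP->; rewrite ?opprK ?eqxx ?orbT.
Qed.

Canonical antipodal_equiv_rel := EquivRelPack antipodal_equiv.

End directions.

(* [direction R n] is P^(n-1), the unit sphere of R^n modulo {1, -1}. *)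
Definition direction (R : realType) (n : nat) : Type :=
  {eq_quot (@antipodal_equiv_rel R n)}%qT.
HB.instance Definition _ (R : realType) (n : nat) := Choice.on (direction R n).

Definition dir (R : realType) (n : nat) (u : sphere R n) : direction R n :=
  (\pi_({eq_quot (@antipodal_equiv_rel R n)}) u)%qT.

Section direction_metric.
Context {R : realType} {n : nat}.
Implicit Types (u v w : sphere R n) (p q : direction R n).

Lemma dirP u v : dir u = dir v <-> val u = val v \/ val u = - val v.
Proof.
have H : dir u = dir v <-> antipodal u v by split=> [/eqquotP|h]//; apply/eqquotP.
rewrite H /antipodal; split=> [/orP[]/eqP|[]->]; rewrite ?eqxx ?orbT//; tauto.
Qed.

Lemma dir_surj p : exists u, p = dir u.
Proof. by exists (repr p); rewrite /dir reprK. Qed.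

(* The chordal distance between the antipodal pairs {u, -u} and {v, -v}. *)
Definition sphere_mindist u v : R :=
  Num.min (mdist (val u) (val v)) (mdist (val u) (- val v)).

Definition direction_dist p q : R := sphere_mindist (repr p) (repr q).

Lemma sphere_dist_opp u v :
  mdist (- val u) (- val v) = mdist (val u) (val v).
Proof. by rewrite /mdist/= /edist -opprD enormN. Qed.

Lemma sphere_dist_oppl u v : mdist (- val u) (val v) = mdist (val u) (- val v).
Proof. by rewrite /mdist/= /edist -opprD opprK enormN. Qed.

Lemma direction_distE u v :
  direction_dist (dir u) (dir v) = sphere_mindist u v.
Proof.
have /dirP Eu : dir (repr (dir u)) = dir u by rewrite /dir reprK.
have /dirP Ev : dir (repr (dir v)) = dir v by rewrite /dir reprK.
rewrite /direction_dist /sphere_mindist.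
case: Eu => ->; case: Ev => ->; rewrite ?opprK ?sphere_dist_opp//.
- by rewrite minC.
- by rewrite sphere_dist_oppl minC.
- by rewrite sphere_dist_oppl.
Qed.

Lemma direction_distxx p : direction_dist p p = 0.
Proof.
by rewrite /direction_dist /sphere_mindist mdistxx min_l// mdist_ge0.
Qed.

Lemma direction_dist_positivity p q : direction_dist p q = 0 -> p = q.
Proof.
have [u ->] := dir_surj p; have [v ->] := dir_surj q.
rewrite direction_distE /sphere_mindist => uv; apply/dirP.
by move: uv; rewrite /Num.min; case: ifP => _ /mdist_positivity; tauto.
Qed.

Lemma direction_dist_sym p q : direction_dist p q = direction_dist q p.
Proof.
rewrite /direction_dist /sphere_mindist metric_sym; congr Num.min.
by rewrite metric_sym sphere_dist_oppl.
Qed.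

Lemma direction_dist_triangle q p r :
  direction_dist p r <= direction_dist p q + direction_dist q r.
Proof.
rewrite /direction_dist /sphere_mindist.
move: (repr p) (repr q) (repr r) => u v w.
have [_|_] := leP (mdist (val u) (val v)) (mdist (val u) (- val v));
  have [_|_] := leP (mdist (val v) (val w)) (mdist (val v) (- val w));
  rewrite ge_min; apply/orP.
- by left; exact: metric_triangle.
- by right; exact: metric_triangle.
- by right; rewrite -(sphere_dist_opp v w) metric_triangle.
- by left; rewrite -(sphere_dist_oppl v w) metric_triangle.
Qed.

HB.instance Definition _ := isMetric.Build R (direction R n)
  direction_distxx direction_dist_positivity direction_dist_sym
  direction_dist_triangle.

End direction_metric.

Definition line (R : realType) (n : nat) (a v : euclidean R n) :
    set (euclidean R n) :=
  [set a + t *: v | t in [set: R]].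

Definition line_has_direction (R : realType) (n : nat)
    (l : set (euclidean R n)) (p : direction R n) : Prop :=
  exists a u, l = line a (val u) /\ p = dir u.

(* Main.v *)
(* Córdoba's L2 argument. If the packing measure of E in dimension s vanishes, E
   is covered by countably many pieces F whose r-separated subsets have at most
   r^-s points for small r. For a direction p in D, the line l given by p has
   E ∩ l of positive (1 - e)-dimensional Hausdorff measure, so for some piece F,
   every cover of F ∩ l by sets of diameter at most r has at least c r^(e - 1)
   members, with c independent of r; sorting D by the piece F and the constant c
   gives a countable cover of D. Given r-separated directions in one part of D,
   take a maximal r-separated set X in F: each of the corresponding lines has at
   least c r^(e - 1) points of X within r, while two lines at angle t share
   O(1/t) such points. Since the directions are r-separated, summing 1/t over
   them costs only r^-1 log(1/r), and Cauchy-Schwarz bounds their number by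
   r^-(s - 1 + O(e)). As e is arbitrary, the packing dimension of D is at most
   s - 1. *)
Require Import Defs.
From mathcomp Require Import all_boot all_order all_algebra.
From mathcomp Require Import all_classical all_reals all_analysis.
From mathcomp Require Import ring lra.

Set Implicit Arguments.
Unset Strict Implicit.
Unset Printing Implicit Defensive.

Import Order.TTheory GRing.Theory Num.Theory.

Local Open Scope classical_set_scope.
Local Open Scope ring_scope.

(** * Counting lemmas *)

(* Cauchy-Schwarz: the square of the number of incidences is at most [#|I|]
   times the number of triples [(i, k, l)] with [i] in [J k] and in [J l]. *)
Lemma incidence_bound (R : realFieldType) (I K : finType) (J : K -> {set I})
    (m w : R) :
  0 < m -> 0 <= w -> (forall k, m <= #|J k|%:R) ->
  (forall k, \sum_(l | l != k) #|J k :&: J l|%:R <= w) ->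
  #|K|%:R <= #|I|%:R * (m^-1 + w / m ^+ 2).
Proof.
move=> m0 w0 mJ Jw.
pose a i : R := \sum_k (i \in J k)%:R.
have cardE (B : {set I}) : #|B|%:R = \sum_i (i \in B)%:R :> R.
  by rewrite -sum1_card natr_sum big_mkcond/=; apply: eq_bigr => i _; case: ifP.
set N : R := #|K|%:R; set M : R := #|I|%:R.
pose S := \sum_i a i; pose Q := \sum_i a i ^+ 2.
have SE : S = \sum_k #|J k|%:R.
  by rewrite /S exchange_big/=; apply: eq_bigr => k _; rewrite cardE.
have NmS : N * m <= S.
  rewrite SE /N -sum1_card natr_sum mulr_suml; apply: ler_sum => k _.
  by rewrite mul1r.
have QS : Q <= S + N * w.
  have -> : Q = \sum_k \sum_l #|J k :&: J l|%:R.
    transitivity (\sum_i \sum_k \sum_l (i \in J k :&: J l)%:R : R).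
      apply: eq_bigr => i _; rewrite expr2 {1}/a mulr_suml.
      apply: eq_bigr => k _; rewrite mulr_sumr; apply: eq_bigr => l _.
      by rewrite inE -natrM mulnb.
    rewrite exchange_big/=; apply: eq_bigr => k _.
    by rewrite exchange_big/=; apply: eq_bigr => l _; rewrite cardE.
  rewrite SE /N -sum1_card natr_sum mulr_suml -big_split/=.
  apply: ler_sum => k _; rewrite (bigD1 k)//= finset.setIid mul1r lerD2l.
  exact: Jw.
(* The sum of the squares [(a i - t) ^+ 2] is nonnegative for every [t]; taking [t = S / M] gives
   Cauchy-Schwarz. *)
have varE (t : R) : 0 <= Q - 2 * t * S + M * t ^+ 2.
  have -> : Q - 2 * t * S + M * t ^+ 2 = \sum_i (a i - t) ^+ 2.
    rewrite /Q /S /M -sum1_card natr_sum !mulr_sumr mulr_suml -sumrB -big_split/=.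
    by apply: eq_bigr => i _; ring.
  by apply: sumr_ge0 => i _; exact: sqr_ge0.
have M0 : 0 <= M by rewrite ler0n.
have N0 : 0 <= N by rewrite ler0n.
have [K0|/card_gt0P[k0 _]] := posnP #|K|.
  by rewrite /N K0 mulr_ge0// addr_ge0 ?invr_ge0 ?divr_ge0 ?exprn_ge0 ?(ltW m0).
have {varE} S2 : S ^+ 2 <= M * Q.
  have [MQ0|M_neq0] := eqVneq M 0.
    (* For [M = 0] the quadratic is affine in [t]; for nonzero [S] this [t] gives it the value
       [- S ^+ 2 - 1], a contradiction. *)
    have := varE (S / 2 + (Q + 1) / 2 / S); have := varE 0.
    rewrite MQ0 !mul0r !addr0 !mulr0 !mul0r subr0 => Q0.
    have [->|S0] := eqVneq S 0; first by rewrite expr0n.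
    have -> : Q - 2 * (S / 2 + (Q + 1) / 2 / S) * S = - S ^+ 2 - 1 by field.
    by have := sqr_ge0 S; lra.
  have := varE (S / M).
  have -> : Q - 2 * (S / M) * S + M * (S / M) ^+ 2 = (M * Q - S ^+ 2) / M by field.
  by rewrite pmulr_lge0 ?invr_gt0 ?lt_def ?M_neq0// subr_ge0.
have N1 : 0 < N by rewrite ltr0n; apply/card_gt0P; exists k0.
have S0 : 0 < S by apply: lt_le_trans NmS; rewrite mulr_gt0.
(* Divide [S ^+ 2 <= M * Q <= M * (S + N * w)] by [S], using [N <= S / m]. *)
have SM : S <= M * (1 + w / m).
  rewrite -(ler_pM2l S0) -expr2 (le_trans S2)// mulrCA ler_wpM2l//.
  rewrite (le_trans QS)// mulrDr mulr1 lerD2l mulrCA mulrC ler_wpM2l//.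
  by rewrite ler_pdivlMr.
have -> : M * (m^-1 + w / m ^+ 2) = M * (1 + w / m) / m by field; exact: lt0r_neq0.
by rewrite ler_pdivlMr// (le_trans NmS).
Qed.

(** Pigeonhole on unit cells: two points of one cell differ by less than 1 in both coordinates,
    hence coincide. *)
Lemma card_separated_rect (R : realType) (I : finType) (A : {set I})
    (f g : I -> R) (K L : nat) :
  (forall i, i \in A -> `|f i| <= K%:R /\ `|g i| <= L%:R) ->
  (forall i j, i \in A -> j \in A -> `|f i - f j| < 1 -> `|g i - g j| < 1 ->
     i = j) ->
  (#|A| <= K.*2.+1 * L.*2.+1)%N.
Proof.
move=> AKL sep.
(* The shift by [n] makes truncation act as the floor; it takes the [2 n + 1] values from 0 to
   [2 n], the last at [x = n]. *)
pose c (n : nat) (x : R) : 'I_n.*2.+1 := inord (Num.truncn (x + n%:R)).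
have cE n x y : `|x| <= n%:R -> `|y| <= n%:R -> c n x = c n y -> `|x - y| < 1.
  move=> xn yn /(congr1 (@nat_of_ord _)); rewrite !inordK//; last first.
  - rewrite ltnS truncn_le_nat -addn1 -addnn natrD natrD.
    by move: xn; rewrite ler_norml; lra.
  - rewrite ltnS truncn_le_nat -addn1 -addnn natrD natrD.
    by move: yn; rewrite ler_norml; lra.
  move=> xy.
  have /andP[x1 x2] : (Num.truncn (x + n%:R))%:R <= x + n%:R <
      (Num.truncn (x + n%:R)).+1%:R.
    by apply: truncn_itv; move: xn; rewrite ler_norml; lra.
  have /andP[y1 y2] : (Num.truncn (y + n%:R))%:R <= y + n%:R <
      (Num.truncn (y + n%:R)).+1%:R.
    by apply: truncn_itv; move: yn; rewrite ler_norml; lra.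
  move: x1 x2 y1 y2; rewrite xy -addn1 natrD ltr_norml; lra.
have cinj : {in A &, injective (fun i => (c K (f i), c L (g i)))}.
  move=> i j iA jA [fij gij]; have [fi gi] := AKL _ iA; have [fj gj] := AKL _ jA.
  by apply: sep => //; [exact: cE fij|exact: cE gij].
rewrite -(card_in_imset cinj) (leq_trans (max_card _))//.
by rewrite card_prod !card_ord.
Qed.

(* The buckets of [`|g i|] of width [h] contain at most one value of each sign. *)
Lemma sum_inv_separated (R : realType) (I : finType) (A : {set I})
    (g : I -> R) (h : R) (n : nat) :
  0 < h -> (forall i, i \in A -> h <= `|g i| < n%:R * h) ->
  (forall i j, i \in A -> j \in A -> `|g i - g j| < h -> i = j) ->
  \sum_(i in A) `|g i|^-1 <= 2 / h * \sum_(1 <= k < n) k%:R^-1.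
Proof.
move=> h0 gA sep.
pose k i := Num.truncn (`|g i| / h).
have kE i : i \in A ->
    ((k i)%:R * h <= `|g i| < (k i).+1%:R * h) /\ (1 <= k i < n)%N.
  move=> /gA /andP[hg gn].
  have gh0 : 0 <= `|g i| / h by rewrite divr_ge0// ltW.
  split; first by rewrite -ler_pdivlMr// -ltr_pdivrMr// truncn_itv.
  by rewrite truncn_gt0 truncn_lt_nat// ler_pdivlMr// ltr_pdivrMr// mul1r hg gn.
apply: (@le_trans _ _ (\sum_(i in A) ((k i)%:R * h)^-1)).
  apply: ler_sum => i iA; have [/andP[ki _] /andP[k1 _]] := kE _ iA.
  have kh0 : 0 < (k i)%:R * h by rewrite mulr_gt0// ltr0n.
  by rewrite lef_pV2// posrE// (lt_le_trans kh0).
case: n => [|n] in gA kE *.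
  rewrite big_pred0 ?big_geq ?mulr0// => i; apply/negP => /kE[_].
  by rewrite ltn0 andbF.
rewrite (partition_big (fun i => inord (k i) : 'I_n.+1)
  (fun j => (0 < j)%N))/=; last first.
  by move=> i /kE[_ /andP[k1 kn]]; rewrite inordK.
rewrite big_geq_mkord/= mulr_sumr; apply: ler_sum => j j0.
pose B := [set i in A | k i == j :> nat]%SET.
have -> : \sum_(i in A | inord (k i) == j) ((k i)%:R * h)^-1 =
    #|B|%:R * (j%:R * h)^-1.
  rewrite mulr_natl -sumr_const; apply: eq_big => [i|i].
    rewrite inE; case iA : (i \in A) => //=.
    by rewrite -val_eqE/= inordK//; have [_ /andP[]] := kE _ iA.
  move=> /andP[iA /eqP/(congr1 (@nat_of_ord _))]; rewrite inordK => [->//|].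
  by have [_ /andP[]] := kE _ iA.
have B2 : (#|B| <= 2)%N.
  rewrite -card_bool -(@card_in_imset _ _ (fun i => 0 < g i) (mem B)) ?max_card//.
  move=> x y; rewrite !inE => /andP[xA /eqP kx] /andP[yA /eqP ky] sgn.
  have [+ _] := kE _ xA; have [+ _] := kE _ yA; rewrite kx ky.
  rewrite -natr1 mulrDl mul1r => /andP[y1 y2] /andP[x1 x2].
  apply: sep => //; rewrite ltr_norml; move: sgn y1 y2 x1 x2.
  case: (ltrP 0 (g x)) => gx; case: (ltrP 0 (g y)) => // gy _.
    by rewrite !gtr0_norm//; lra.
  by rewrite !ler0_norm//; lra.
have -> : 2 / h * (j : nat)%:R^-1 = 2 * (j%:R * h)^-1 by rewrite invfM; ring.
by rewrite ler_wpM2r ?invr_ge0 ?mulr_ge0 ?ler0n ?(ltW h0)// ler_nat.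
Qed.

(** The induction step is [ln (1 + x) <= x] at [x = - 1 / (n + 1)]. At [n = 0] the convention
    [ln 0 = 0] applies. *)
Lemma harmonic_le_ln (R : realType) (n : nat) :
  \sum_(1 <= k < n.+1) k%:R^-1 <= 1 + ln (n%:R : R).
Proof.
elim: n => [|n IH]; first by rewrite big_geq// ln0// addr0 ler01.
have [->|n0] := eqVneq n 0%N; first by rewrite big_nat1 invr1 ln1 addr0.
rewrite big_nat_recr//= (le_trans (lerD IH (lexx _)))// -addrA lerD2l.
have n1 : 0 < n.+1%:R :> R by rewrite ltr0n.
have n2 : 0 < n%:R :> R by rewrite ltr0n lt0n.
have : ln (1 + - n.+1%:R^-1 : R) <= - n.+1%:R^-1.
  by apply: le_ln1Dx; rewrite ltrN2 invf_lt1// ltr1n ltnS lt0n.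
have -> : 1 + - n.+1%:R^-1 = n%:R / n.+1%:R :> R.
  by rewrite -[n.+1%:R]natr1; field; rewrite natr1 lt0r_neq0.
by rewrite ln_div ?posrE//; move: (ln _) (ln _) (_^-1) => a b c; lra.
Qed.

(** * Separated families and packing measures *)

Section separated_families.
Context {R : realType} {T : metricType R}.
Implicit Types (A B E : set T) (xs : seq T) (r s t : R).

(** The inequality is strict so that closed balls of radius [r / 2] about the points are
    disjoint. *)
Definition separated r A xs : Prop :=
  [/\ uniq xs, {in xs, forall x, A x} &
      {in xs &, forall x y, x != y -> r < mdist x y}].

Lemma separated_cons r A x xs : 0 <= r -> separated r A xs -> A x ->
  (forall y, y \in xs -> r < mdist y x) -> separated r A (x :: xs).
Proof.
move=> r0 [uxs Axs sep] Ax xfar; split => /=.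
- by rewrite uxs andbT; apply/negP => /xfar; rewrite mdistxx ltNge r0.
- by move=> y; rewrite inE => /predU1P[->//|/Axs].
- move=> y z; rewrite !inE => /predU1P[->|yxs] /predU1P[->|zxs].
  + by rewrite eqxx.
  + by rewrite metric_sym => _; exact: xfar.
  + by move=> _; exact: xfar.
  + exact: sep.
Qed.

(** Any point farther than [r] from a family of largest size could be added to it; [N] ensures that
    a largest size exists. *)
Lemma maximal_separated r A (N : nat) : 0 <= r ->
  (forall xs, separated r A xs -> (size xs <= N)%N) ->
  exists2 xs, separated r A xs &
    forall y, A y -> exists2 x, x \in xs & mdist x y <= r.
Proof.
move=> r0 AN.
pose P n := `[< exists2 xs, separated r A xs & size xs = n >].
have P0 : exists n, P n by exists 0%N; apply/asboolP; exists [::].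
have PN n : P n -> (n <= N)%N by move=> /asboolP[xs /AN ? <-].
case: (ex_maxnP P0 PN) => n /asboolP[xs xsA <-] nmax.
exists xs => // y Ay; apply: contrapT => ny.
have /nmax : P (size xs).+1.
  apply/asboolP; exists (y :: xs) => //; apply: separated_cons => // x xxs.
  by rewrite ltNge; apply/negP => xy; apply: ny; exists x.
by rewrite ltnn.
Qed.

(** The balls of radius [r / 2] about the points form a packing, each with weight r^s. *)
Lemma packing_premeasure_separated s d A r xs : 0 < r <= d *+ 2 ->
  (0 < size xs)%N -> separated r A xs ->
  (((size xs)%:R * r `^ s)%:E <= packing_premeasure s d A)%E.
Proof.
move=> /andP[r0 rd]; case: xs => // x0 xs' _ [uxs Axs sep].
apply: ereal_sup_ubound => /=.
set xs := x0 :: xs' in uxs Axs sep *.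
exists `I_(size xs), (nth x0 xs), (fun=> r / 2); split.
  split=> [i ilt|i j ilt jlt [z [/= zi zj]]].
    split; first by apply: Axs; rewrite mem_nth.
    by rewrite divr_gt0// ler_pdivrMr// mulr_natr.
  apply/eqP; rewrite -(nth_uniq x0 ilt jlt uxs); apply: contrapT => /negP ij.
  have := sep _ _ (mem_nth x0 ilt) (mem_nth x0 jlt) ij.
  apply/negP; rewrite -leNgt (le_trans (metric_triangle _ z _))//.
  by rewrite (metric_sym z) [leRHS](splitr r) lerD.
rewrite esum_fset//=; last by move=> i _; rewrite lee_fin powR_ge0.
by rewrite -fsbig_ord sumEFin (mulrC 2) divfK// sumr_const card_ord mulr_natl.
Qed.

Lemma packing_premeasure0_ge0 (x0 : T) s A : (0 <= packing_premeasure0 s A)%E.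
Proof.
apply: le_ereal_inf_tmp => _ [d _ <-]; apply: ereal_sup_ubound.
exists set0, (fun=> x0), (fun=> 1); split; last by rewrite esum_set0.
by split => //; rewrite /trivIset.
Qed.

(** In a cover of total premeasure below 1, each piece has [packing_premeasure0] below 1. As this is
    an infimum over scales, some scale [d] already gives every packing of the piece weight at most
    1. *)
Lemma packing_measure_eq0_separated (x0 : T) s E : packing_measure s E = 0%E ->
  exists2 F : nat -> set T, E `<=` \bigcup_i F i &
    forall i, exists2 d, 0 < d & forall r xs, 0 < r <= d ->
      separated r (F i) xs -> (size xs)%:R * r `^ s <= 1.
Proof.
move=> E0.
have /ereal_inf_lt[_ [F EF <-] F1] : (packing_measure s E < 1)%E.
  by rewrite E0 lte_fin ltr01.
exists F => // i.
have : (packing_premeasure0 s (F i) < 1)%E.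
  apply: le_lt_trans F1; rewrite (@nneseriesD1 _ _ i)//; last first.
    by move=> k _; exact: packing_premeasure0_ge0.
  rewrite leeDl// nneseries_ge0// => k _ _; exact: packing_premeasure0_ge0.
move=> /ereal_inf_lt[_ [d d0 <-] Fd].
exists d => // r xs /andP[r0 rd] xsF.
have [->|xs0] := posnP (size xs); first by rewrite mul0r.
rewrite -lee_fin (le_trans _ (ltW Fd))// packing_premeasure_separated//.
by rewrite r0 (le_trans rd)// mulr2n lerDr ltW.
Qed.

End separated_families.

(** * Hausdorff measure and covers *)

Section hausdorff_covers.
Context {R : realType} {T : metricType R}.
Implicit Types (A V : set T) (s d : R).

Lemma diam_pow_ge0 s A : (0 <= diam_pow s A)%E.
Proof. by rewrite /diam_pow; case: ifP => // _; exact: poweR_ge0. Qed.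

Lemma diam_pow_set0 s : diam_pow s (set0 : set T) = 0%E.
Proof. by rewrite /diam_pow eqxx. Qed.

Lemma le_diam_pow s d A : 0 <= s -> (diam A <= d%:E)%E ->
  (diam_pow s A <= (d `^ s)%:E)%E.
Proof.
move=> s0 Ad; rewrite /diam_pow; case: ifPn => [_|/set0P[x Ax]].
  by rewrite lee_fin powR_ge0.
have A0 : (0 <= diam A)%E.
  by apply: ereal_sup_ubound; exists x => //; exists x => //; rewrite mdistxx.
rewrite -poweR_EFin gt0_ler_poweR// in_itv/= ?A0 ?leey//.
by rewrite (le_trans A0 Ad).
Qed.

Lemma diam_set0 : diam (set0 : set T) = -oo%E.
Proof.
by apply/eqP; rewrite -leeNy_eq; apply: ge_ereal_sup => _ [x []].
Qed.

Lemma diam_cball (x : T) d : (diam (cball x d) <= (d *+ 2)%:E)%E.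
Proof.
apply: ge_ereal_sup => _ [y yd [z zd <-]]; rewrite lee_fin.
rewrite (le_trans (metric_triangle _ x _))// mulr2n.
by rewrite (metric_sym y) lerD.
Qed.

(** The finite rows are padded with [set0], of diameter [-oo] and weight 0, and the double family is
    enumerated by a bijection of [nat] with pairs. *)
Lemma hausdorff_premeasure_double s d A (n : nat -> nat)
    (V : nat -> nat -> set T) (a : nat -> \bar R) :
  A `<=` \bigcup_i \bigcup_(j < n i) V i j ->
  (forall i j, (j < n i)%N -> (diam (V i j) <= d%:E)%E) ->
  (forall i, (\sum_(j < n i) diam_pow s (V i j) <= a i)%E) ->
  (hausdorff_premeasure s d A <= \sum_(i <oo) a i)%E.
Proof.
move=> AV Vd Va.
pose W (p : nat * nat) := if (p.2 < n p.1)%N then V p.1 p.2 else set0.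
have /card_esym/ppcard_eqP[f] := card_nat2.
have sumW0 i : (0 <= \sum_(j < n i) diam_pow s (V i j))%E.
  by apply: sume_ge0 => j _; exact: diam_pow_ge0.
apply: ge_ereal_inf; exists (\sum_(k <oo) diam_pow s (W (f k)))%E.
  exists (W \o f) => //; split => [x /AV[i _ [j ji Vx]]|k].
    by exists (f^-1%FUN (i, j)) => //=; rewrite invK ?inE// /W /= ji.
  by rewrite /= /W; case: ifP => [/Vd//|_]; rewrite diam_set0 leNye.
rewrite nneseries_esumT; last by move=> k; exact: diam_pow_ge0.
rewrite -(@reindex_esum _ _ _ setT setT f (diam_pow s \o W))//=.
have <- : [set: nat] `*`` (fun=> [set: nat]) = setT by apply/seteqP; split.
rewrite -(esum_esum (a := fun i j => diam_pow s (W (i, j))))/=; last first.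
  by move=> *; exact: diam_pow_ge0.
rewrite nneseries_esumT => [|i]; last exact: le_trans (Va i).
apply: le_esum => i _; apply: le_trans (Va i).
rewrite (eq_esum (b := fun j => if j \in `I_(n i) then diam_pow s (V i j) else 0%E)).
  rewrite -esum_mkcond esum_fset//; last by move=> *; exact: diam_pow_ge0.
  by rewrite -fsbig_ord.
move=> j _; have -> : (j \in `I_(n i)) = (j < n i)%N by apply/idP/idP; rewrite inE.
by rewrite /W/=; case: ifP => // _; exact: diam_pow_set0.
Qed.

(** A box-counting rather than a Hausdorff content: only finite covers with one common diameter
    bound compete, as a net at a single scale provides. *)
Definition uniform_content_ge s (c : R) A : Prop :=
  forall d n (V : nat -> set T), 0 < d -> A `<=` \bigcup_(j < n) V j ->
    (forall j, (j < n)%N -> (diam (V j) <= d%:E)%E) -> c <= n%:R * d `^ s.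

(** Otherwise every [B i] has single-scale covers of arbitrarily small cost, and their union over
    [i] makes the premeasure of [A] arbitrarily small at each scale. *)
Lemma hausdorff_measure_neq0_content s A (B : nat -> set T) : 0 < s ->
  A `<=` \bigcup_i B i -> hausdorff_measure s A <> 0%E ->
  exists i, exists2 c, 0 < c & uniform_content_ge s c (B i).
Proof.
move=> s0 AB; apply: contra_notP => noc; apply/eqP; rewrite eq_le; apply/andP; split.
  apply: ge_ereal_sup => _ [d /= d0 <-]; apply/lee_addgt0Pr => e e0.
  rewrite add0e.
  (* The bound [e / 2 ^ i.+1] makes the total at most [e]; the bound d^s forces the scale of a cover
     with at least one member below [d]. *)
  have H i : exists p : R * nat * (nat -> set T),
      [/\ 0 < p.1.1, B i `<=` \bigcup_(j < p.1.2) p.2 j,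
       (forall j, (j < p.1.2)%N -> (diam (p.2 j) <= p.1.1%:E)%E) &
       p.1.2%:R * p.1.1 `^ s < Num.min (e / (2 ^ i.+1)%:R) (d `^ s)].
    apply: contrapT => nop; apply: noc; exists i.
    exists (Num.min (e / (2 ^ i.+1)%:R) (d `^ s)).
      by rewrite lt_min powR_gt0// divr_gt0// ltr0n expn_gt0.
    move=> d' n V d'0 BV Vd; rewrite leNgt; apply/negP => lt.
    by apply: nop; exists (d', n, V).
  have [p pP] := choice H.
  apply: le_trans (epsilon_trick0 xpredT (ltW e0)).
  apply: (@hausdorff_premeasure_double _ _ _
    (fun i => (p i).1.2) (fun i => (p i).2)).
  - by move=> x /AB[i _ Bx]; have [_ /(_ _ Bx) ? _ _] := pP i; exists i.
  - move=> i j ji; have [d'0 _ /(_ _ ji) Vd] := pP i; rewrite lt_min => /andP[_ lt].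
    apply: (le_trans Vd); rewrite lee_fin leNgt; apply/negP => dd'.
    move: lt; rewrite ltNge => /negP; apply.
    rewrite (le_trans (ge0_ler_powR (ltW s0) _ _ (ltW dd')))//
      ?nnegrE ?(ltW d0) ?(ltW d'0)//.
    by rewrite ler_peMl ?powR_ge0// ler1n (leq_ltn_trans _ ji).
  - move=> i; have [d'0 _ Vd] := pP i; rewrite lt_min => /andP[/ltW lt _].
    apply: (@le_trans _ _ (\sum_(j < (p i).1.2) ((p i).1.1 `^ s)%:E)%E).
      by apply: lee_sum => j _; exact: (le_diam_pow (ltW s0) (Vd _ (ltn_ord j))).
    by rewrite sumEFin sumr_const card_ord lee_fin -[leLHS]mulr_natl.
apply: ereal_sup_ge; exists (hausdorff_premeasure s 1 A); first by exists 1 => //=.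
apply: le_ereal_inf_tmp => _ [U _ <-]; apply: nneseries_ge0 => *.
exact: diam_pow_ge0.
Qed.

Lemma hausdorff_dim_gt_measure_neq0 s A : 0 <= s -> (s%:E < hausdorff_dim A)%E ->
  hausdorff_measure s A <> 0%E.
Proof.
move=> s0 sA A0; move: sA; rewrite ltNge => /negP; apply.
by apply: ereal_inf_lbound; exists s.
Qed.

End hausdorff_covers.

(** * Real powers and dyadic scales *)

Lemma powR_exprn (R : realType) (a s : R) (n : nat) : 0 <= a ->
  (a ^+ n) `^ s = (a `^ s) ^+ n.
Proof.
move=> a0; transitivity (a `^ (n%:R * s)); first by rewrite powRrM powR_mulrn.
by rewrite mulrC powRrM powR_mulrn// powR_ge0.
Qed.

Lemma exists_powR_le (R : realType) (a d e : R) : 0 < a -> 0 < d -> 0 < e ->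
  exists2 r, 0 < r <= d & r `^ a <= e.
Proof.
move=> a0 d0 e0; exists (Num.min d (e `^ a^-1)).
  by rewrite ge_min lexx lt_min d0 powR_gt0.
rewrite -[leRHS]powRr1 ?(ltW e0)// -(mulVf (lt0r_neq0 a0)) powRrM.
by rewrite ge0_ler_powR ?nnegrE ?le_min ?powR_ge0 ?(ltW a0) ?(ltW d0)//
  ge_min lexx orbT.
Qed.

Lemma dyadic_bracket (R : realType) (r : R) : 0 < r <= 1 ->
  exists k, 2^-1 ^+ k.+1 < r <= 2^-1 ^+ k.
Proof.
move=> /andP[r0 r1].
have ex : exists n, 2^-1 ^+ n < r.
  have [n rn] : exists n, r^-1 < n%:R.
    by exists (Num.truncn r^-1).+1; exact: truncnS_gt.
  exists n; rewrite exprVn invf_plt ?posrE ?exprn_gt0// (lt_trans rn)//.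
  by rewrite -natrX ltr_nat ltn_expl.
case: (ex_minnP ex) => -[|n] nr nmin; first by rewrite expr0 ltNge r1 in nr.
by exists n; rewrite nr leNgt; apply/negP => /nmin; rewrite ltnn.
Qed.

Lemma sum_geometric_le (R : realFieldType) (x : R) (n : nat) : 0 <= x < 1 ->
  \sum_(i < n) x ^+ i <= (1 - x)^-1.
Proof.
move=> /andP[x0 x1]; rewrite -[leRHS]mul1r ler_pdivlMr ?subr_gt0//.
rewrite -[1 - x]opprB mulrN mulrC -subrX1 opprB lerBlDr lerDl.
exact: exprn_ge0.
Qed.

(** * Packing dimension bounded by counts of separated points *)

Section packing_of_separated.
Context {R : realType} {T : metricType R}.
Implicit Types (A D : set T) (r s t d C : R).

(** A centre within [rad i] of [c i] would lie in both balls, so distinct centres are farther apart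
    than the radii. *)
Lemma packing_separated d r A I (c : nat -> T) (rad : nat -> R) (xs : seq nat) :
  is_packing d A I c rad -> 0 <= r -> uniq xs ->
  {in xs, forall i, I i /\ r < rad i} -> separated r A (map c xs).
Proof.
move=> [cA disj] r0 uxs Irad.
have far i j : I i -> I j -> i <> j -> rad i < mdist (c i) (c j).
  move=> Ii Ij ij; rewrite ltNge; apply/negP => cij.
  apply: ij; apply: disj => //; exists (c j); split => //=.
  by have [_ /andP[/ltW]] := cA _ Ij; rewrite /cball/= mdistxx.
split=> [|_ /mapP[i /Irad[Ii _] ->]|_ _ /mapP[i ixs ->] /mapP[j jxs ->] cij].
- rewrite map_inj_in_uniq// => i j /Irad[Ii _] /Irad[Ij _] cij.
  apply: contrapT => ij; have := far _ _ Ii Ij ij; rewrite cij mdistxx.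
  by have [_ /andP[/ltW]] := cA _ Ii; rewrite leNgt => /negbTE ->.
- by have [] := cA _ Ii.
- have [Ii ri] := Irad _ ixs; have [Ij _] := Irad _ jxs.
  by apply: (lt_trans ri); apply: far => // ij; rewrite ij eqxx in cij.
Qed.

(* The balls of radius in [(d / 2 ^ (j + 1), d / 2 ^ j]] have centres separated
   by [d / 2 ^ (j + 1)], so the packing sum is dominated by a geometric series. *)
Lemma packing_premeasure_le t s C d A : 0 <= t -> s < t -> 0 < d ->
  (forall r xs, 0 < r <= d -> separated r A xs -> (size xs)%:R <= C * r `^ (- s)) ->
  (packing_premeasure t d A <=
    (C * 4 `^ t / (1 - 2^-1 `^ (t - s)) * d `^ (t - s))%:E)%E.
Proof.
move=> t0 st d0 Asep.
have C0 : 0 <= C.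
  (* The empty family at scale [d] forces [C] to be nonnegative. *)
  have := Asep d [::]; rewrite d0 lexx/= => /(_ isT) H.
  by rewrite -(pmulr_lge0 C (powR_gt0 (- s) d0)) H.
set x := 2^-1 `^ (t - s).
have x01 : 0 < x < 1.
  have x1 : 1 `^ (t - s) = 1 :> R by rewrite powR1.
  rewrite powR_gt0//= -[ltRHS]x1 gt0_ltr_powR ?subr_gt0 ?nnegrE//.
  by rewrite invf_lt1// ltr1n.
apply: ge_ereal_sup => _ [I [c [rad [pack ->]]]].
apply: ge_ereal_sup => _ [X [finX XI] <-].
rewrite fsbig_finite//= sumEFin lee_fin.
have [cA _] := pack.
have /choice[k kP] i : exists k, X i -> d * 2^-1 ^+ k.+1 < rad i <= d * 2^-1 ^+ k.
  have [Xi|nXi] := pselect (X i); last by exists 0%N.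
  have [_ /andP[ri rd]] := cA _ (XI _ Xi).
  have [|k krad] := @dyadic_bracket _ (rad i / d); last first.
    by exists k => _; move: krad; rewrite ltr_pdivlMr// ler_pdivrMr// ![_ * d]mulrC.
  by rewrite divr_gt0//= ler_pdivrMr// mul1r.
set xs := finmap.enum_fset (fset_set X).
have xsX i : i \in xs -> X i by rewrite in_fset_set// inE.
pose K := \max_(i <- xs) k i.
have kK i : i \in xs -> (k i <= K)%N by move=> ixs; exact: leq_bigmax_seq.
rewrite big_seq (partition_big (fun i => inord (k i) : 'I_K.+1) predT)//=.
apply: (@le_trans _ _ (\sum_(j < K.+1) C * 4 `^ t * d `^ (t - s) * x ^+ j)).
  apply: ler_sum => j _; set r := d * 2^-1 ^+ j.+1.
  have r0 : 0 < r by rewrite mulr_gt0// exprn_gt0.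
  have rd : r <= d by rewrite ger_pMr// exprn_ile1// invf_le1// ler1n.
  pose ys := [seq i <- xs | k i == j].
  have ysP i : i \in ys -> I i /\ r < rad i <= r *+ 2.
    rewrite mem_filter => /andP[/eqP kij /xsX Xi]; split; first exact: XI.
    have := kP _ Xi; rewrite kij -/r => /andP[-> /le_trans->//=].
    by rewrite /r exprS -[leRHS]mulr_natr; move: (_ ^+ _) => z; lra.
  have ysep : separated r A (map c ys).
    apply: (packing_separated pack) => [||i /ysP[? /andP[]]//].
      exact: ltW.
    by rewrite filter_uniq// finmap.fset_uniq.
  have := Asep r _; rewrite r0 rd => /(_ _ isT ysep); rewrite size_map => szys.
  (* Radii in class [j] are at most [2 r], so each weight is at most (4 r)^t. *)
  apply: (@le_trans _ _ (\sum_(i <- ys) (4 * r) `^ t)).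
    rewrite big_filter [leRHS]big_seq_cond.
    rewrite [leLHS](_ : _ =
        \sum_(i <- xs | (i \in xs) && (k i == j)) (2 * rad i) `^ t).
      apply: ler_sum => i /andP[ixs kij].
      have [|_ /andP[ri ri2]] := ysP i; first by rewrite mem_filter kij.
      have rad0 := lt_trans r0 ri.
      by apply: ge0_ler_powR => //; rewrite ?nnegrE; move: ri2;
        rewrite -mulr_natr; lra.
    apply: eq_bigl => i; case ixs: (i \in xs) => //=.
    by rewrite -val_eqE/= inordK// ltnS kK.
  rewrite big_const_seq count_predT iter_addr_0 -[leLHS]mulr_natl.
  rewrite powRM// ?(ltW r0)// (le_trans (ler_wpM2r _ szys)) ?mulr_ge0 ?powR_ge0//.
  have -> : C * r `^ (- s) * (4 `^ t * r `^ t) = C * 4 `^ t * r `^ (t - s).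
    rewrite [t - s]addrC powRD ?lt0r_neq0 ?implybT//; ring.
  rewrite -(mulrA (C * _)) ler_wpM2l ?mulr_ge0 ?powR_ge0//.
  rewrite /r powRM ?exprn_ge0 ?(ltW d0)// ler_wpM2l ?powR_ge0//.
  rewrite powR_exprn// -/x exprS.
  by rewrite ler_piMl ?exprn_ge0//; case/andP: x01 => /ltW ? /ltW.
rewrite -mulr_sumr [leRHS]mulrAC ler_wpM2l ?mulr_ge0 ?powR_ge0//.
by apply: sum_geometric_le; case/andP: x01 => /ltW -> ->.
Qed.

(** At scale [r] the premeasure of each piece is O(r^(t - s)), which tends to 0 with [r]; so the
    cover by the pieces witnesses zero packing measure in dimension [t]. *)
Lemma packing_dim_le (x0 : T) t D (B : nat -> set T) : 0 <= t ->
  D `<=` \bigcup_i B i ->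
  (forall i, exists s d C, [/\ s < t, 0 < d &
    forall r xs, 0 < r <= d -> separated r (B i) xs ->
      (size xs)%:R <= C * r `^ (- s)]) ->
  (packing_dim D <= t%:E)%E.
Proof.
move=> t0 DB Bsep; apply: ereal_inf_lbound; exists t => //; split => //.
apply/eqP; rewrite eq_le; apply/andP; split; last first.
  apply: le_ereal_inf_tmp => _ [U _ <-]; apply: nneseries_ge0 => *.
  exact: packing_premeasure0_ge0.
apply: ge_ereal_inf; exists (\sum_(i <oo) packing_premeasure0 t (B i))%E.
  by exists B.
rewrite eseries0// => i _ _; apply/eqP; rewrite eq_le packing_premeasure0_ge0// andbT.
have [s [d [C [st d0 Bi]]]] := Bsep i.
apply/lee_addgt0Pr => e e0; rewrite add0e.
set a := C * 4 `^ t / (1 - 2^-1 `^ (t - s)).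
have [r /andP[r0 rd] re] : exists2 r, 0 < r <= d & r `^ (t - s) <= e / (`|a| + 1).
  by apply: exists_powR_le; rewrite ?subr_gt0// divr_gt0// ltr_wpDl.
apply: ge_ereal_inf; exists (packing_premeasure t r (B i)); first by exists r.
apply: (le_trans (packing_premeasure_le t0 st r0 _)).
  move=> r' xs /andP[r'0 r'r]; apply: Bi.
  by rewrite r'0 (le_trans r'r).
rewrite lee_fin -/a (@le_trans _ _ ((`|a| + 1) * r `^ (t - s)))//.
  by rewrite ler_wpM2r ?powR_ge0// (le_trans (ler_norm _))// lerDl.
by rewrite mulrC -ler_pdivlMr// ltr_wpDl.
Qed.

End packing_of_separated.

(** * Lines and directions in the plane *)

Section plane.
Context {R : realType}.
Implicit Types (x y z w a b u v : euclidean R 2) (r : R).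

Definition dot x y : R :=
  (x : 'rV[R]_2) 0 0 * (y : 'rV[R]_2) 0 0 + (x : 'rV[R]_2) 0 1 * (y : 'rV[R]_2) 0 1.

Definition cross x y : R :=
  (x : 'rV[R]_2) 0 0 * (y : 'rV[R]_2) 0 1 - (x : 'rV[R]_2) 0 1 * (y : 'rV[R]_2) 0 0.

Lemma enorm_sqr x : enorm x ^+ 2 = dot x x.
Proof.
rewrite sqr_sqrtr; last by apply: sumr_ge0 => i _; exact: sqr_ge0.
rewrite !big_ord_recl big_ord0 addr0 /dot -!expr2.
by have -> : lift ord0 ord0 = 1 :> 'I_2 by exact: val_inj.
Qed.

Lemma enorm_unit x : dot x x = 1 -> enorm x = 1.
Proof.
by move=> x1; apply/eqP; rewrite -(@pexpr_eq1 _ _ 2) ?enorm_ge0// enorm_sqr x1.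
Qed.

Lemma dotBl x y z : dot (x - y) z = dot x z - dot y z.
Proof. by rewrite /dot !mxE; ring. Qed.

Lemma crossBl x y z : cross (x - y) z = cross x z - cross y z.
Proof. by rewrite /cross !mxE; ring. Qed.

Lemma dotZl (k : R) x z : dot (k *: x) z = k * dot x z.
Proof. by rewrite /dot !mxE; ring. Qed.

Lemma crossZl (k : R) x z : cross (k *: x) z = k * cross x z.
Proof. by rewrite /cross !mxE; ring. Qed.

Lemma crossxx x : cross x x = 0.
Proof. by rewrite /cross; ring. Qed.

Lemma sphere_dot (u : sphere R 2) : dot (val u) (val u) = 1.
Proof. by rewrite -enorm_sqr (eqP (valP u)) expr1n. Qed.

(** Pythagoras: [dot w u] and [cross w u] are, up to sign, the coordinates of [w] along [u] and its
    normal. *)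
Lemma dot_cross_sqr u w : dot u u = 1 ->
  enorm w ^+ 2 = dot w u ^+ 2 + cross w u ^+ 2.
Proof.
move=> u1; rewrite enorm_sqr -[LHS]mulr1 -u1 /dot /cross; ring.
Qed.

Lemma cross_change_frame u v w : dot u u = 1 ->
  cross w v = dot w u * cross u v + cross w u * dot u v.
Proof.
by move=> u1; rewrite -[LHS]mulr1 -u1 /dot /cross; ring.
Qed.

Lemma cross_le_enorm u w : dot u u = 1 -> `|cross w u| <= enorm w.
Proof.
move=> u1; rewrite -(@ler_pXn2r _ 2)// ?nnegrE ?enorm_ge0//.
by rewrite (dot_cross_sqr w u1) real_normK ?num_real// lerDr sqr_ge0.
Qed.

Lemma dot_le_enorm u w : dot u u = 1 -> `|dot w u| <= enorm w.
Proof.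
move=> u1; rewrite -(@ler_pXn2r _ 2)// ?nnegrE ?enorm_ge0//.
by rewrite (dot_cross_sqr w u1) real_normK ?num_real// lerDl sqr_ge0.
Qed.

Lemma cross_line a u y : line a u y -> cross (y - a) u = 0.
Proof. by move=> [t _ <-]; rewrite addrC addKr crossZl crossxx mulr0. Qed.

(** [cross (x - a) u] is the signed distance from [x] to the line. *)
Lemma cross_near_line a u x y r : dot u u = 1 -> line a u y ->
  mdist x y <= r -> `|cross (x - a) u| <= r.
Proof.
move=> u1 /cross_line ya; apply: le_trans.
have -> : cross (x - a) u = cross (x - y) u by move: ya; rewrite !crossBl; lra.
exact: cross_le_enorm.
Qed.

(** Two strips of half-width [r] whose angle has sine [th] meet in a parallelogram of length O(r /
    th) along [u]. In units of [r / 2], points of the family differ by at least 1 in one of the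
    coordinates along and across [u], and [card_separated_rect] counts them. *)
Lemma strip_overlap (I : finType) (A : {set I}) (x : I -> euclidean R 2)
    a b u v r :
  dot u u = 1 -> dot v v = 1 -> 0 < `|cross u v| -> 0 < r ->
  {in A, forall i, `|cross (x i - a) u| <= r /\ `|cross (x i - b) v| <= r} ->
  {in A &, forall i j, i != j -> r < mdist (x i) (x j)} ->
  #|A|%:R <= 95 / `|cross u v|.
Proof.
move=> u1 v1 uv0 r0 strip sep.
set th := `|cross u v|.
have th1 : th <= 1.
  by rewrite (le_trans (cross_le_enorm _ v1))// enorm_unit.
have [->|[i0 i0A]] := set_0Vmem A; first by rewrite cards0 divr_ge0// ltW.
pose f i := dot (x i - x i0) u / (r / 2).
pose g i := cross (x i - a) u / (r / 2).
have [K thK Kth] : exists2 K : nat, 8 / th < K%:R & K%:R <= 9 / th.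
  exists (Num.truncn (8 / th)).+1; first exact: truncnS_gt.
  rewrite -natr1 (@le_trans _ _ (8 / th + 1 / th))//; last by lra.
  rewrite lerD ?truncn_le ?divr_ge0 ?(ltW uv0)//.
  by rewrite ler_pdivlMr// mul1r.
(* The constant: [(2 K + 1) * 5 <= (18 / th + 1 / th) * 5 = 95 / th], as [th <= 1]. *)
suff AK : (#|A| <= K.*2.+1 * (2.*2.+1))%N.
  rewrite (@le_trans _ _ ((2 * (9 / th) + 1 / th) * 5))//; last by lra.
  rewrite (@le_trans _ _ (K.*2.+1 * (2.*2.+1))%:R) ?ler_nat// natrM ler_wpM2r//.
  have -> : K.*2.+1%:R = 2 * K%:R + 1 :> R by rewrite -natr1 -mul2n natrM.
  rewrite lerD ?ler_wpM2l//.
  by rewrite ler_pdivlMr// mul1r.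
have r20 : 0 < r / 2 by rewrite divr_gt0.
have normE (k : R) : `|k / (r / 2)| = `|k| / (r / 2).
  by rewrite normrM [X in _ * X]gtr0_norm// invr_gt0.
apply: (@card_separated_rect _ _ _ f g).
  move=> i iA; have [iu iv] := strip _ iA; have [ju jv] := strip _ i0A.
  rewrite !normE; split; last by rewrite ler_pdivrMr//; lra.
  set w := x i - x i0.
  have wu : `|cross w u| <= 2 * r.
    have -> : cross w u = cross (x i - a) u - cross (x i0 - a) u.
      by rewrite !crossBl; ring.
    by rewrite (le_trans (ler_normB _ _))//; lra.
  have wv : `|cross w v| <= 2 * r.
    have -> : cross w v = cross (x i - b) v - cross (x i0 - b) v.
      by rewrite !crossBl; ring.
    by rewrite (le_trans (ler_normB _ _))//; lra.
  (* Solving the change of frame for [dot w u] bounds it by [4 r / th], that is [8 / th] units of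
     [r / 2]. *)
  have dth : `|dot w u| * th <= 4 * r.
    rewrite -normrM.
    have -> : dot w u * cross u v = cross w v - cross w u * dot u v.
      by rewrite (cross_change_frame v w u1); ring.
    rewrite (le_trans (ler_normB _ _))// normrM.
    have : `|cross w u| * `|dot u v| <= `|cross w u| * 1.
      rewrite ler_wpM2l// (le_trans (dot_le_enorm _ v1))//.
      by rewrite enorm_unit.
    by lra.
  rewrite ltW// (le_lt_trans _ thK)// ler_pdivlMr// mulrAC.
  by rewrite ler_pdivrMr//; lra.
move=> i j iA jA.
have -> : f i - f j = dot (x i - x j) u / (r / 2).
  by rewrite -mulrBl !dotBl; congr (_ * _); ring.
have -> : g i - g j = cross (x i - x j) u / (r / 2).
  by rewrite -mulrBl !crossBl; congr (_ * _); ring.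
rewrite !normE !ltr_pdivrMr// !mul1r => fij gij.
apply/eqP; apply: contraT => /(sep _ _ iA jA); rewrite ltNge => /negP[].
have sqr_le (k : R) : `|k| < r / 2 -> k ^+ 2 <= (r / 2) ^+ 2.
  by rewrite ltr_norml => /andP[k1 k2]; rewrite -subr_ge0 subr_sqr mulr_ge0//; lra.
rewrite -[mdist _ _]/(enorm (x i - x j)).
rewrite -(@ler_pXn2r _ 2)// ?nnegrE ?enorm_ge0 ?(ltW r0)//.
rewrite (dot_cross_sqr _ u1); have := sqr_le _ fij; have := sqr_le _ gij.
have -> : (r / 2) ^+ 2 = r ^+ 2 / 4 by field.
have := sqr_ge0 r.
by move: (r ^+ 2) (dot _ _ ^+ 2) (cross _ _ ^+ 2) => p q t; lra.
Qed.

End plane.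

Section direction_frames.
Context {R : realType}.
Implicit Types (u v w : sphere R 2).

(* With [th] the angle in [-pi/2, pi/2] between the lines spanned by [u] and
   [v], this is [tan (th / 2)], a bi-Lipschitz chart of the projective line. *)
Definition half_tan u v : R :=
  (if 0 <= dot (val v) (val u) then 1 else -1) * cross (val v) (val u) /
  (1 + `|dot (val v) (val u)|).

Lemma half_tanxx u : half_tan u u = 0.
Proof. by rewrite /half_tan crossxx mulr0 mul0r. Qed.

Lemma half_tan_le_cross u v : `|half_tan u v| <= `|cross (val u) (val v)|.
Proof.
rewrite /half_tan 2!normrM normrV ?unitfE ?gt_eqF ?ltr_pwDl//.
rewrite [X in X * _ / _](_ : _ = 1) ?mul1r; last first.
  by case: ifP; rewrite ?normrN normr1.
have -> : cross (val v) (val u) = - cross (val u) (val v) by rewrite /cross; ring.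
rewrite normrN [X in _ / X]gtr0_norm ?ltr_pwDl// ler_pdivrMr ?ltr_pwDl//.
by rewrite ler_peMr// lerDl.
Qed.

Lemma half_tan_le1 u v : `|half_tan u v| <= 1.
Proof.
apply: le_trans (half_tan_le_cross _ _) _.
by rewrite (le_trans (cross_le_enorm _ (sphere_dot v)))// (eqP (valP u)).
Qed.

(** The squared chord equals [(1 + c) * (1 + d)] times the squared difference of half-angle
    tangents, and both factors are at most 2. *)
Lemma chord_le_half_tan (c s d t : R) : 0 <= c <= 1 -> 0 <= d <= 1 ->
  c ^+ 2 + s ^+ 2 = 1 -> d ^+ 2 + t ^+ 2 = 1 ->
  (c - d) ^+ 2 + (s - t) ^+ 2 <= 4 * (s / (1 + c) - t / (1 + d)) ^+ 2.
Proof.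
move=> /andP[c0 c1] /andP[d0 d1] cs dt.
have c10 : 1 + c != 0 by rewrite gt_eqF// ltr_pwDl.
have d10 : 1 + d != 0 by rewrite gt_eqF// ltr_pwDl.
have -> : (c - d) ^+ 2 + (s - t) ^+ 2 =
    (1 + c) * (1 + d) * (s / (1 + c) - t / (1 + d)) ^+ 2.
  have sE : s ^+ 2 = (1 - c) * (1 + c) by rewrite -[LHS](addKr (c ^+ 2)) cs; ring.
  have tE : t ^+ 2 = (1 - d) * (1 + d) by rewrite -[LHS](addKr (d ^+ 2)) dt; ring.
  have -> : (1 + c) * (1 + d) * (s / (1 + c) - t / (1 + d)) ^+ 2 =
      s ^+ 2 / (1 + c) * (1 + d) + t ^+ 2 / (1 + d) * (1 + c) - 2 * s * t.
    by field; rewrite c10 d10.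
  rewrite sE tE !mulfK//.
  have -> : (c - d) ^+ 2 + (s - t) ^+ 2 =
     (c ^+ 2 + s ^+ 2) + (d ^+ 2 + t ^+ 2) - 2 * c * d - 2 * s * t by ring.
  by rewrite cs dt; ring.
rewrite ler_wpM2r ?sqr_ge0//.
have -> : 4 = 2 * 2 :> R by ring.
by apply: ler_pM; lra.
Qed.

(** The sign [e] picks the representative on the half circle centred at [u]; the chord between the
    representatives dominates the distance of the directions. *)
Lemma direction_dist_half_tan u v w :
  direction_dist (dir v) (dir w) <= 2 * `|half_tan u v - half_tan u w|.
Proof.
pose e v' : R := if 0 <= dot (val v') (val u) then 1 else -1.
have eE v' : e v' * dot (val v') (val u) = `|dot (val v') (val u)|.
  rewrite /e; case: ifPn => [h|]; first by rewrite mul1r ger0_norm.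
  by rewrite -ltNge mulN1r => /ltr0_norm ->.
have esq v' : e v' * e v' = 1 by rewrite /e; case: ifP => _; ring.
rewrite direction_distE /sphere_mindist.
apply: (@le_trans _ _ (enorm (e v *: val v - e w *: val w))).
  have eN (x y : euclidean R 2) : enorm (- x - y) = enorm (x + y).
    by rewrite -opprD enormN.
  have mE (x y : euclidean R 2) : mdist x y = enorm (x - y) by [].
  rewrite !mE opprK /e ge_min.
  by case: ifP => _; case: ifP => _;
    rewrite ?scale1r ?scaleN1r ?opprK ?eN ?lexx ?orbT//
    [- _ + _]addrC enormB lexx.
have e2 (x : R) : 0 <= 2 * `|x| by rewrite mulr_ge0.
rewrite -(@ler_pXn2r _ 2)// ?nnegrE ?enorm_ge0//.
rewrite (dot_cross_sqr _ (sphere_dot u)) dotBl crossBl !dotZl !crossZl !eE.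
rewrite exprMn real_normK ?num_real//.
have -> : 2 ^+ 2 = 4 :> R by ring.
have le1 v' : 0 <= `|dot (val v') (val u)| <= 1.
  by rewrite normr_ge0 (le_trans (dot_le_enorm _ (sphere_dot u)))// (eqP (valP v')).
apply: chord_le_half_tan => //;
  rewrite real_normK ?num_real// exprMn [e _ ^+ 2]expr2 esq mul1r;
  rewrite -(dot_cross_sqr _ (sphere_dot u)) enorm_sqr; exact: sphere_dot.
Qed.

End direction_frames.

(** * Counting separated directions *)

(** [incidence_bound] applies to a maximal separated family in [F], with [J k] its points within [r]
    of the part of [F] on the line chosen for [k]. The [r]-balls about [J k] cover that part, so the
    content bound gives [m]. *)
Lemma separated_directions_count (R : realType) (F : set (euclidean R 2))
    (G : set (direction R 2)) (s sigma c d r : R) (ps : seq (direction R 2)) :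
  0 < c -> 0 < r <= d -> r <= 1 ->
  (forall xs, separated r F xs -> (size xs)%:R * r `^ s <= 1) ->
  (forall p, G p -> exists a u, p = dir u /\
    uniform_content_ge sigma c (F `&` line a (val u))) ->
  separated r G ps ->
  (size ps)%:R <= r `^ (- s) * ((2 * r) `^ sigma / c +
    380 / r * (1 + ln (2 / r)) * ((2 * r) `^ sigma / c) ^+ 2).
Proof.
move=> c0 /andP[r0 rd] r1 netF linesG [ups psG sep].
have netF' xs : separated r F xs -> (size xs)%:R <= r `^ (- s).
  by move=> /netF; rewrite powRN -ler_pdivlMr ?powR_gt0// div1r.
have [xs xsF xsnet] : exists2 xs, separated r F xs &
    forall y, F y -> exists2 x, x \in xs & mdist x y <= r.
  apply: (@maximal_separated _ _ _ _ (Num.truncn (r `^ (- s)))); first exact: ltW.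
  by move=> xs /netF'; rewrite truncn_ge_nat// powR_ge0.
pose I := seq_sub xs; pose K := seq_sub ps.
have /choice[q qP] (k : K) : exists q : euclidean R 2 * sphere R 2,
    ssval k = dir q.2 /\ uniform_content_ge sigma c (F `&` line q.1 (val q.2)).
  by have [a [u [ku cu]]] := linesG _ (psG _ (ssvalP k)); exists (a, u).
pose a k := (q k).1; pose u k := (q k).2.
have unit_u k : dot (val (u k)) (val (u k)) = 1 := sphere_dot _.
pose J (k : K) := [set i : I | `[< exists2 y, (F `&` line (a k) (val (u k))) y &
  mdist (ssval i) y <= r >]]%SET.
have rs0 : 0 < (2 * r) `^ sigma by rewrite powR_gt0// mulr_gt0.
pose m := c / (2 * r) `^ sigma.
have m0 : 0 < m by rewrite divr_gt0.
have mJ k : m <= #|J k|%:R.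
  rewrite ler_pdivrMr//.
  have [_ /(_ (2 * r) #|J k|)] := qP k.
  pose V j := nth set0 [seq cball (ssval i) r | i <- enum (J k)] j.
  move=> /(_ V); apply.
  - by rewrite mulr_gt0.
  - move=> y [Fy ly]; have [x xxs xy] := xsnet _ Fy.
    have iJ : SeqSub xxs \in enum (J k).
      by rewrite mem_enum inE; apply/asboolP; exists y.
    exists (index (SeqSub xxs) (enum (J k))); first by rewrite /= cardE index_mem.
    by rewrite /V (nth_map (SeqSub xxs)) ?index_mem// nth_index.
  - move=> j jJ; have /card_gt0P[i0 _] : (0 < #|J k|)%N by apply: leq_trans jJ.
    by rewrite /V (nth_map i0) -?cardE// mulr_natl diam_cball.
(* Separation by [r] becomes separation by [r / 2] in the chart centred at [u k]. *)
have far k i j : i != j -> r / 2 < `|half_tan (u k) (u i) - half_tan (u k) (u j)|.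
  move=> ij; have [Ei _] := qP i; have [Ej _] := qP j.
  have dij : r < mdist (ssval i) (ssval j).
    apply: sep (ssvalP i) (ssvalP j) _; apply: contra_neq ij; exact: val_inj.
  have dE (p p' : direction R 2) : mdist p p' = direction_dist p p' by [].
  have := direction_dist_half_tan (u k) (u i) (u j).
  rewrite -dE -Ei -Ej ltr_pdivrMr// mulrC; exact: lt_le_trans.
have far0 k l : l != k -> r / 2 < `|half_tan (u k) (u l)|.
  by move=> /(far k); rewrite half_tanxx subr0.
(* Here 380 is 95 from the strip overlap times 4 from [2 / (r / 2)] in the bucket sum; the logarithm
   bounds the harmonic sum up to [2 / r]. *)
pose w := 380 / r * (1 + ln (2 / r)).
have w0 : 0 <= w.
  apply: mulr_ge0; first exact: divr_ge0 (ler0n _ _) (ltW r0).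
  rewrite addr_ge0// ln_ge0// ler_pdivlMr// mul1r.
  by rewrite (le_trans r1)// ler1n.
have Jw k : \sum_(l | l != k) #|J k :&: J l|%:R <= w.
  pose A := [set l | l != k]%SET.
  have h0 : 0 < r / 2 by rewrite divr_gt0.
  (* Chart values are at most 1 in absolute value, so [n] buckets of width [r / 2] contain them
     all. *)
  pose n := (Num.truncn (2 / r)).+1.
  have nr : 1 < n%:R * (r / 2).
    have := truncnS_gt (2 / r); rewrite -/n ltr_pdivrMr//.
    by rewrite mulrA ltr_pdivlMr// mul1r.
  have le95 l : l != k -> #|J k :&: J l|%:R <= 95 / `|half_tan (u k) (u l)|.
    move=> lk; have ht0 := lt_trans h0 (far0 _ _ lk).
    have cr0 := lt_le_trans ht0 (half_tan_le_cross (u k) (u l)).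
    apply: (@le_trans _ _ (95 / `|cross (val (u k)) (val (u l))|)).
      apply: (@strip_overlap _ _ _ (@ssval _ xs) (a k) (a l) _ _ r) => //.
        move=> i; rewrite !inE => /andP[/asboolP[y [_ ly] xy] /asboolP[z [_ lz] xz]].
        by split; [exact: cross_near_line ly xy|exact: cross_near_line lz xz].
      move=> i j _ _ ij; have [_ _ sepF] := xsF.
      by apply: sepF (ssvalP i) (ssvalP j) _; apply: contra_neq ij; exact: val_inj.
    by rewrite ler_wpM2l// lef_pV2// half_tan_le_cross.
  apply: (@le_trans _ _ (95 * \sum_(l in A) `|half_tan (u k) (u l)|^-1)).
    rewrite mulr_sumr [leRHS](eq_bigl (fun l => l != k)) => [|l]; last by rewrite inE.
    by apply: ler_sum.
  have /(_ h0) := @sum_inv_separated _ _ A (fun l => half_tan (u k) (u l)) (r / 2) n.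
  have gA i : i \in A -> r / 2 <= `|half_tan (u k) (u i)| < n%:R * (r / 2).
    rewrite inE => /far0/ltW ->; exact: le_lt_trans (half_tan_le1 _ _) nr.
  have gsep i j : i \in A -> j \in A ->
      `|half_tan (u k) (u i) - half_tan (u k) (u j)| < r / 2 -> i = j.
    move=> _ _ ij; apply/eqP; apply: contraLR ij => /(far k).
    by rewrite -leNgt => /ltW.
  move=> /(_ gA gsep) SA.
  have harm : \sum_(1 <= l < n) l%:R^-1 <= 1 + ln (2 / r).
    apply: le_trans (harmonic_le_ln _ _) _; rewrite lerD2l ler_ln ?posrE.
    - by rewrite truncn_le divr_ge0// ltW.
    - rewrite ltr0n truncn_gt0 ler_pdivlMr// mul1r (le_trans r1)//.
      by rewrite ler1n.
    - by rewrite divr_gt0.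
  rewrite (_ : w = 95 * (2 / (r / 2) * (1 + ln (2 / r)))).
    rewrite ler_wpM2l// (le_trans SA)// ler_wpM2l//.
    by rewrite divr_ge0// ltW.
  by rewrite /w; field; exact: lt0r_neq0.
have := incidence_bound m0 w0 mJ Jw.
rewrite !card_seq_sub//; last by case: xsF.
move=> /le_trans; apply; rewrite /m invf_div.
have -> : w / (c / (2 * r) `^ sigma) ^+ 2 = w * ((2 * r) `^ sigma / c) ^+ 2.
  by rewrite -exprVn invf_div.
rewrite ler_wpM2r ?netF'// addr_ge0//; first by rewrite divr_ge0// ltW.
by rewrite mulr_ge0// sqr_ge0.
Qed.

(* The exponent [s - 1 + 3 e] is what [separated_directions_count] gives for
   [sigma = 1 - e], one further [e] absorbing the logarithm. *)
Lemma count_bound_powR (R : realType) (s e c : R) : 0 < e < 1 -> 0 < c ->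
  exists C : R, forall r, 0 < r <= 1 ->
    r `^ (- s) * ((2 * r) `^ (1 - e) / c +
      380 / r * (1 + ln (2 / r)) * ((2 * r) `^ (1 - e) / c) ^+ 2) <=
    C * r `^ (- (s - 1 + 3 * e)).
Proof.
move=> /andP[e0 e1] c0.
exists (2 / c + 380 * (3 + e^-1) * 4 / c ^+ 2) => r /andP[r0 r1].
have r_neq0 : r != 0 by rewrite gt_eqF.
have c_neq0 : c != 0 by rewrite gt_eqF.
have e_neq0 : e != 0 by rewrite gt_eqF.
have rD (a b : R) : r `^ (a + b) = r `^ a * r `^ b by rewrite powRD// r_neq0 implybT.
set q := r `^ (- e); set P := r `^ (- s).
have P0 : 0 <= P by exact: powR_ge0.
have q1 : 1 <= q.
  by rewrite /q powRN invf_ge1 ?powR_gt0// -(powRr0 r) ger_powR ?r0 ?r1 ?ltW.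
have -> : r `^ (- (s - 1 + 3 * e)) = P * (r * q ^+ 3).
  have -> : - (s - 1 + 3 * e) = - s + (1 + (- e + (- e + - e))) by ring.
  by rewrite !rD powRr1 ?(ltW r0)// !exprS expr0 mulr1.
have xle : (2 * r) `^ (1 - e) <= 2 * (r * q).
  rewrite powRM// ?(ltW r0)// rD powRr1 ?(ltW r0)//.
  rewrite ler_wpM2r ?mulr_ge0 ?powR_ge0 ?(ltW r0)//.
  by apply: ler1_powR; [rewrite ler1n|rewrite gerBl ltW].
(* Since [ln x < x] at [x = q], [- ln r] is at most [q / e]; the rest, [1 + ln 2], is below
   [3 <= 3 q]. *)
have Lle : 1 + ln (2 / r) <= (3 + e^-1) * q.
  rewrite ln_div ?posrE//.
  have ln2 : ln 2 < 2 :> R by apply: ln_sublinear.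
  have lnr : - ln r <= e^-1 * q.
    rewrite mulrC ler_pdivlMr// mulrC mulrN -mulNr -ln_powR ltW// ln_sublinear//.
    by rewrite powR_gt0.
  by move: lnr; rewrite mulrDl; move: (_^-1 * q) => z; lra.
have L0 : 0 <= 1 + ln (2 / r).
  rewrite addr_ge0// ln_ge0// ler_pdivlMr// mul1r (le_trans r1)//.
  by rewrite ler1n.
set x := (2 * r) `^ (1 - e) in xle *; set L := 1 + ln (2 / r) in Lle L0 *.
have x0 : 0 <= x by exact: powR_ge0.
have rq0 : 0 <= r * q by rewrite mulr_ge0 ?powR_ge0// ltW.
rewrite [leRHS]mulrCA ler_wpM2l// [leRHS]mulrDl lerD//.
  rewrite (@le_trans _ _ (2 / c * (r * q)))//.
    by rewrite mulrAC ler_wpM2r// invr_ge0 ltW.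
  rewrite ler_wpM2l//; first by rewrite divr_ge0// ltW.
  by rewrite ler_wpM2l ?(ltW r0)// -[leLHS]expr1 ler_weXn2l.
have -> : 380 * (3 + e^-1) * 4 / c ^+ 2 * (r * q ^+ 3) =
    380 / r * ((3 + e^-1) * q) * (2 * (r * q) / c) ^+ 2.
  by field; rewrite r_neq0 c_neq0 e_neq0.
have r380 : 0 <= 380 / r := divr_ge0 (ler0n _ _) (ltW r0).
have xc : x / c <= 2 * (r * q) / c by rewrite ler_wpM2r// invr_ge0 ltW.
have xc0 : 0 <= x / c by rewrite divr_ge0// ltW.
apply: ler_pM; [exact: mulr_ge0|exact: sqr_ge0|exact: ler_wpM2l|].
by rewrite ler_pXn2r// nnegrE// (le_trans xc0).
Qed.

(** * Countable decomposition of the directions *)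

Theorem corollary1p6 (R : realType) (E : set (euclidean R 2))
    (D : set (direction R 2))
    (hD : D = [set p | exists l : set (euclidean R 2),
      line_has_direction l p /\ hausdorff_dim (E `&` l) = 1%E]) :
  D !=set0 -> (packing_dim D + 1 <= packing_dim E)%E.
Proof.
move=> [p0 Dp0]; apply: le_ereal_inf_tmp => _ [s [s0 Es] <-].
apply/lee_addgt0Pr => eta eta0.
(* The bound [eta / 4] gives [3 * e < eta]; the bound 1/2 keeps [1 - e] positive. *)
pose e := Num.min (2^-1) (eta / 4).
have e0 : 0 < e by rewrite lt_min invr_gt0 divr_gt0 ?ltr0n.
have e1 : e < 1 by rewrite gt_min invf_lt1// ltr1n.
have e_eta : 3 * e < eta.
  by have : e <= eta / 4; [rewrite ge_min lexx orbT|lra].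
have [F EF Fsep] := packing_measure_eq0_separated (0 : euclidean R 2) Es.
pose G (im : nat * nat) : set (direction R 2) := [set p | exists a u, p = dir u /\
  uniform_content_ge (1 - e) im.2.+1%:R^-1 (F im.1 `&` line a (val u))].
pose B k := if unpickle k is Some im then G im else set0.
have DB : D `<=` \bigcup_k B k.
  rewrite hD => p [_ [[a [u [-> pu]]] dim1]].
  have H0 : hausdorff_measure (1 - e) (E `&` line a (val u)) <> 0%E.
    apply: hausdorff_dim_gt_measure_neq0; rewrite ?subr_ge0 ?ltW//.
    by rewrite dim1 lte_fin gtrBl.
  have [||i [c c0 ci]] := hausdorff_measure_neq0_content
    (B := fun i => F i `&` line a (val u)) _ _ H0.
  - by rewrite subr_gt0.
  - by move=> x [/EF[i _ Fix] lx]; exists i.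
  (* With [m] the truncation of [c^-1], [1 / (m + 1)] lies below [c]. *)
  exists (pickle (i, Num.truncn c^-1)) => //.
  rewrite /B pickleK; exists a, u; split => // d n V d0 FV Vd.
  apply: le_trans (ci _ _ _ d0 FV Vd).
  by rewrite -[leRHS]invrK lef_pV2 ?posrE ?invr_gt0 ?ltr0n// ltW// truncnS_gt.
pose tau := s - 1 + 3 * e.
have Bsep k : exists2 d, 0 < d & exists C, forall r xs, 0 < r <= d ->
    separated r (B k) xs -> (size xs)%:R <= C * r `^ (- tau).
  rewrite /B; case: unpickle => [[i n]|]; last first.
    exists 1 => //; exists 0 => r [|x xs] _; first by rewrite mul0r.
    by move=> [_ /(_ x (mem_head _ _))].
  have [d d0 Fd] := Fsep i.
  have [||C HC] := @count_bound_powR _ s e n.+1%:R^-1.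
  - by rewrite e0.
  - by rewrite invr_gt0 ltr0n.
  exists (Num.min d 1); first by rewrite lt_min d0 ltr01.
  exists C => r ps /andP[r0]; rewrite le_min => /andP[rd r1] psG.
  apply: le_trans (HC r _); last by rewrite r0.
  apply: (@separated_directions_count _ (F i) (G (i, n)) _ _ _ d) => //.
  - by rewrite r0.
  - by move=> xs; apply: Fd; rewrite r0.
(* [packing_dim_le] needs a nonnegative exponent. Here [D] being nonempty enters: a singleton is
   separated at every scale, so 1 <= C r^(-tau) for all small [r], which fails for negative
   [tau]. *)
have tau0 : 0 <= tau.
  have [k _ Bp0] := DB _ Dp0.
  have [d d0 [C Ck]] := Bsep k.
  rewrite leNgt; apply/negP => tau0.
  have C1 : 0 < `|C| + 1 by rewrite ltr_wpDl.
  have [|||r r_d rC] := @exists_powR_le _ (- tau) d (2^-1 / (`|C| + 1)).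
  - by rewrite oppr_gt0.
  - exact: d0.
  - by rewrite divr_gt0// invr_gt0.
  have /(Ck _ _ r_d) : separated r (B k) [:: p0].
    split=> // [x|x y]; first by rewrite inE => /eqP ->.
    by rewrite !inE => /eqP -> /eqP ->; rewrite eqxx.
  apply/negP; rewrite -ltNge (@le_lt_trans _ _ ((`|C| + 1) * r `^ (- tau)))//.
    by rewrite ler_wpM2r ?powR_ge0// (le_trans (ler_norm _))// lerDl.
  move: rC; rewrite ler_pdivlMr// mulrC => /le_lt_trans->//.
  by rewrite invf_lt1// ltr1n.
have tau_t : tau < s - 1 + eta by rewrite /tau ltrD2l.
have /leeD2r : (packing_dim D <= (s - 1 + eta)%:E)%E.
  apply: (packing_dim_le p0 _ DB); first exact: ltW (le_lt_trans tau0 tau_t).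
  by move=> k; have [d d0 [C Ck]] := Bsep k; exists tau, d, C.
move=> /(_ 1%E)/le_trans; apply.
by rewrite -!EFinD lee_fin; lra.
Qed.
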